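(* Let $G$ be the class of all systems of forms of subset data definitions, and let $G^{\neg\beta}$ be the subclass of systems that contain no form of type $\beta$. Then $G^{\neg\beta}<G$, i.e. $G$ is strictly more expressive than $G^{\neg\beta}$.
   Context: **Syntax.** The alphabet contains symbols of predicates, constants, functions, variables, and types of set names $S^i$ ($i\in\mathbb N$). Terms are the empty term $\lambda$, variables, constants, and $f(t_1,\dots,t_k)$; $v(t)$ is the set of variables of $t$. A schema of set names is $S^i_t$ (type $i$, index term $t$). An elementary selector is $x\in S^j_t$ or $S^i_x\in S^j_t$ with $x$ a variable. A selector level $U$ is a finite set of elementary selectors for distinct variables $x_1,\dots,x_n$ from sets with index terms $t_1,\dots,t_n$, with $U^-=v(t_1)\cup\dots\cup v(t_n)$ disjoint from $U^+=\{x_1,\dots,x_n\}$. A hierarchy of selectors is a finite sequence of levels $U_1,\dots,U_n$ with pairwise disjoint $U_i^+$ and such that each $x\in U_i^-$ lies in $U_j^+$ for some $j>i$; it is closed if $U_n^-=\emptyset$. An elementary form is one of ($\alpha$) $S^i_c=\{c_1,\dots,c_k\}$; ($\beta$) $S^i_t=\{Q_1x_1\in S_{t_1}\dots Q_nx_n\in S_{t_n}\,p(x_1,\dots,x_n,z_1,\dots,z_m);U\}$; ($\gamma$) $S^i_t=\{S^{i_0}_{t_0},\,Q_1x_1\in S_{t_1}\dots Q_nx_n\in S_{t_n}\,p(x,y,x_1,\dots,x_n,z_1,\dots,z_m);U\}$; ($\delta$) $S^i_t=\{t_0(z_1,\dots,z_m);U\}$; where $Q_j\in\{\forall,\exists\}$,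 the $c_j$ are constants or set names with constant index, variables may also range over set names, $\{z_1,\dots,z_m\}\subset v(t)$, and $U$ is a closed hierarchy of selectors for the variables in $v(t)$ (the parameters). Here $p$ may be a predicate symbol or a secondary predicate, i.e. a Boolean combination of predicate symbols applied to terms. A system of forms is a finite set of forms whose left sides have different types and which has a definition for each type of set name used. **Interpretation.** An interpretation $J$ of a system $F$ over a universe $\mathcal V$ of data gives a finite set $\Omega\subset\mathcal V$ of start data, a finite set $\Omega^\lambda$ of secondary data contained in the union of the images of the functions, an element of $\Omega\cup\Omega^\lambda$ for each constant, a map $\mathcal V^j\to\{\text{true},\text{false}\}$ for each $j$-ary predicate symbol, and a map $\mathcal V^j\to\mathcal V$ for each $j$-ary function symbol. $S(F,J)$ is the set of concrete names $S^i_v$, with $v$ a value of the index term $t$ for parameters selected by $U$. **Selected sets.** A named family $M$ is a set of pairs $(S^i_v,M^i_v)$ with $M^i_v\subset\Omega\cup\Omega^\lambda\cup S(F,J)$; write $M(S^i_v)=M^i_v$. An assignment $\xi$ of the variables of a hierarchy $U$ is acceptable if $\xi(x)\in M(S^j_{t(\xi)})$ (resp. $S^i_{\xi(x)}\in M(S^j_{t(\xi)})$) for each elementary selector $x\in S^j_t$ (resp. $S^i_x\in S^j_t$) of $U$. For a form with left side $S^i_t$, $\Sigma_v$ is the set of acceptable $\xi$ with $t(\xi)=v$. Quantifiers $Qx\in S_t$ range over the elements of the set named $S_t$ in the family (finite conjunctions/disjunctions). $M$ is agreed with $F$ on $J$ if for each form with left side $S^i_t$: - type $\alpha$: $(S^i_c,\{c_1,\dots,c_k\})\in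 M$; - type $\beta$: $(S^i_v,M^i_v)\in M$ iff $v$ is a value of $t$ on $\Omega\cup\Omega^\lambda$, $\Sigma_v\ne\emptyset$, and the formula of the form is true on $\Sigma_v$; - type $\gamma$: $(S^i_v,M^i_v)\in M$ iff $v$ is a value of $t$, $\Sigma_v\neq\emptyset$, and $M^i_v$ is the minimal set that contains the elements of the base set $S^{i_0}_{t_0}$ (for the corresponding parameter values) and contains $d_0$ whenever for some $d\in M^i_v$ the formula $Q_1x_1\in S_{t_1}\dots Q_nx_n\in S_{t_n}\,p(d_0,d,x_1,\dots,x_n,\dots)$ is true on $\Sigma_v$; - type $\delta$: $(S^i_v,M^i_v)\in M$ iff $v$ is a value of $t$, $\Sigma_v\ne\emptyset$, and $M^i_v=(\Omega\cup\Omega^\lambda\cup S(F,J))\cap\{t_0(\xi):\xi\in\Sigma_v\}$. $M$ is selected by $F$ on $J$ (a variant of selection) if it is agreed with $F$ and no family obtained from $M$ by enlarging only one of its sets is agreed with $F$. **Comparison.** Interpretations $J_1,J_2$ are similar if they have the same $\Omega$, the same $\Omega^\lambda$ and the same interpretation of basic predicate and function symbols (they may differ only in predicate expressions). Systems $F_1,F_2$ with the same basic predicate and function symbols are equivalent regarding a name $S_a$ if for any interpretation of $F_1$ there is a similar interpretation of $F_2$ for which the selected sets with name $S_a$ are the same. For classes of systems, $\Phi_1\ge\Phi_2$ if for each system $F_2\in\Phi_2$ and set name $S_a$ there is a system $F_1\in\Phi_1$ equivalent to $F_2$ regarding $S_a$ (the new system may use new variables and secondary predicates). $\Phi_1>\Phi_2$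 (equivalently $\Phi_2<\Phi_1$) means $\Phi_1\ge\Phi_2$ but not $\Phi_2\ge\Phi_1$. *)

(* Defs.v *)
From mathcomp Require Import all_boot.
From mathcomp Require Import boolp classical_sets cardinality.
From Stdlib Require List.

Set Implicit Arguments.
Unset Strict Implicit.
Unset Printing Implicit Defensive.

Local Open Scope classical_set_scope.

(* Variables, constants and types of set names are drawn from the infinite
   supply [nat]; a signature fixes the basic predicate and function symbols. *)
Record signature := Signature {
  psym : finType; par : psym -> nat;
  fsym : finType; far : fsym -> nat }.

Section Syntax.
Variable Sg : signature.

Inductive term :=
| Var of nat
| Con of nat
| App (f : fsym Sg) of ('I_(far f) -> term).

(* The empty term has no datum as its value, so it occurs only as the index of
   a set name, where it is [None]. *)
Definition index := option term.

Fixpoint tvars (t : term) : seq nat :=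
  match t with
  | Var x => [:: x]
  | Con _ => [::]
  | App f ts => flatten [seq tvars (ts k) | k <- enum 'I_(far f)]
  end.

Definition ivars (t : index) : seq nat := if t is Some t' then tvars t' else [::].

(* A constant index: a constant or the empty term. *)
Definition cindex := option nat.

Definition index_of_cindex (c : cindex) : index := omap Con c.

(* [x \in S^j_t] when [spat = None], [S^i_x \in S^j_t] when [spat = Some i]. *)
Record selector := Selector {
  svar : nat; spat : option nat; stype : nat; sindex : index }.

Definition level := seq selector.
Definition hierarchy := seq level.

Definition lplus (L : level) : seq nat := [seq svar s | s <- L].
Definition lminus (L : level) : seq nat := flatten [seq ivars (sindex s) | s <- L].
Definition hplus (U : hierarchy) : seq nat := flatten [seq lplus L | L <- U].

Definition wf_level (L : level) : Prop :=
  uniq (lplus L) /\ ~~ has (mem (lplus L)) (lminus L).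

Definition wf_hierarchy (U : hierarchy) : Prop :=
  [/\ forall i, i < size U -> wf_level (nth [::] U i),
      forall i j, i < j < size U ->
        ~~ has (mem (lplus (nth [::] U i))) (lplus (nth [::] U j)) &
      forall i x, i.+1 < size U -> x \in lminus (nth [::] U i) ->
        exists j, i < j < size U /\ x \in lplus (nth [::] U j)].

Definition closed_hierarchy (U : hierarchy) : Prop :=
  wf_hierarchy U /\ lminus (last [::] U) = [::].

(* Secondary predicates: Boolean combinations of atoms. *)
Inductive pexp :=
| Atom (P : psym Sg) of ('I_(par P) -> term)
| Not of pexp
| And of pexp & pexp
| Or of pexp & pexp.

Fixpoint pvars (p : pexp) : seq nat :=
  match p with
  | Atom P ts => flatten [seq tvars (ts k) | k <- enum 'I_(par P)]
  | Not q => pvars q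
  | And q r | Or q r => pvars q ++ pvars r
  end.

Inductive quantifier := Forall | Exists.

(* The bound variable may also stand for the index of a set name, as in
   [Q S^i_x \in S^j_t]. *)
Definition prefix := seq (quantifier * selector).

Definition qvars (q : prefix) : seq nat := [seq svar e.2 | e <- q].

Inductive celem :=
| CElem of nat
| CName of nat & cindex.

Inductive body :=
| Alpha of seq celem
| Beta of prefix & pexp
| Gamma (i0 : nat) (t0 : index) (x y : nat) of prefix & pexp
| Delta of term.

Record form := Form {
  ftype : nat; findex : index; fbody : body; fsel : hierarchy }.

Definition system := seq form.

Fixpoint scoped_prefix (bound : seq nat) (q : prefix) : Prop :=
  if q is (_, s) :: q' then
    [/\ {subset ivars (sindex s) <= bound}, svar s \notin bound
      & scoped_prefix (svar s :: bound) q']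
  else True.

Definition wf_body (t : index) (U : hierarchy) (b : body) : Prop :=
  match b with
  | Alpha _ => (exists c, t = index_of_cindex c) /\ U = [::]
  | Beta q p =>
      scoped_prefix (ivars t) q /\ {subset pvars p <= qvars q ++ ivars t}
  | Gamma _ t0 x y q p =>
      [/\ {subset ivars t0 <= ivars t},
          [&& x != y, x \notin ivars t & y \notin ivars t],
          scoped_prefix (x :: y :: ivars t) q
        & {subset pvars p <= x :: y :: qvars q ++ ivars t}]
  | Delta t0 => {subset tvars t0 <= ivars t}
  end.

Definition wf_form (phi : form) : Prop :=
  [/\ closed_hierarchy (fsel phi),
      {subset ivars (findex phi) <= hplus (fsel phi)}
    & wf_body (findex phi) (fsel phi) (fbody phi)].

Definition sel_types (s : selector) : seq nat :=
  stype s :: (if spat s is Some i then [:: i] else [::]).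

Definition body_types (b : body) : seq nat :=
  match b with
  | Alpha cs => pmap (fun c => if c is CName i _ then Some i else None) cs
  | Beta q _ => flatten [seq sel_types e.2 | e <- q]
  | Gamma i _ _ _ q _ => i :: flatten [seq sel_types e.2 | e <- q]
  | Delta _ => [::]
  end.

Definition form_types (phi : form) : seq nat :=
  flatten [seq sel_types s | s <- flatten (fsel phi)] ++ body_types (fbody phi).

Definition wf_system (F : system) : Prop :=
  [/\ forall phi, List.In phi F -> wf_form phi,
      uniq [seq ftype phi | phi <- F]
    & {subset flatten [seq form_types phi | phi <- F]
         <= [seq ftype phi | phi <- F]}].

Definition is_beta (phi : form) : bool :=
  if fbody phi is Beta _ _ then true else false.

End Syntax.

Arguments Alpha {Sg}.

(* The universe of data is the type [V]; functions and predicates are total on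
   it. *)
Record interpretation (Sg : signature) (V : Type) := Interpretation {
  Omega : set V;
  OmegaL : set V;
  cst : nat -> V;
  prd : forall P : psym Sg, ('I_(par P) -> V) -> bool;
  fn : forall f : fsym Sg, ('I_(far f) -> V) -> V;
  Omega_finite : finite_set Omega;
  OmegaL_finite : finite_set OmegaL;
  OmegaL_image : OmegaL `<=` \bigcup_(f in [set: fsym Sg]) range (@fn f);
  cst_in : forall c, (Omega `|` OmegaL) (cst c) }.

(* Concrete set names [S^i_v]; [v = None] is the value of the empty term. *)
Definition name (V : Type) := (nat * option V)%type.

Inductive obj (V : Type) :=
| Datum of V
| Name of name V.

Section Semantics.
Variables (Sg : signature) (V : Type) (J : interpretation Sg V).

Definition data : set V := Omega J `|` OmegaL J.

Definition assignment := nat -> obj V.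

Definition update (xi : assignment) (x : nat) (o : obj V) : assignment :=
  fun z => if z == x then o else xi z.

(* Functions are applied to data only, so a term has no value under [xi] when
   an argument of a function is a set name. *)
Inductive value (xi : assignment) : term Sg -> obj V -> Prop :=
| value_var x : value xi (Var Sg x) (xi x)
| value_con c : value xi (Con Sg c) (Datum (cst J c))
| value_app f ts vs :
    (forall k, value xi (ts k) (Datum (vs k))) ->
    value xi (@App Sg f ts) (Datum (fn J vs)).

Definition ivalue (xi : assignment) (t : index Sg) (v : option V) : Prop :=
  match t, v with
  | None, None => True
  | Some t', Some d => value xi t' (Datum d)
  | _, _ => False
  end.

Definition value_on_data (t : index Sg) (v : option V) : Prop :=
  exists xi, (forall x, x \in ivars t -> (@Datum V @` data) (xi x)) /\ ivalue xi t v.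

Definition cname (i : nat) (c : cindex) : name V := (i, omap (cst J) c).

Definition cvalue (c : celem) : obj V :=
  match c with
  | CElem c => Datum (cst J c)
  | CName i c => Name (cname i c)
  end.

Fixpoint peval (xi : assignment) (p : pexp Sg) : Prop :=
  match p with
  | Atom P ts =>
      exists2 vs, forall k, value xi (ts k) (Datum (vs k)) & prd J vs
  | Not q => ~ peval xi q
  | And q r => peval xi q /\ peval xi r
  | Or q r => peval xi q \/ peval xi r
  end.

(* A secondary predicate p(xs) is a relation on data: it does not hold when the
   value of some argument is a set name, even if it contains negations. *)
Definition pholds (xi : assignment) (xs : seq nat) (p : pexp Sg) : Prop :=
  (forall x, x \in xs -> exists d, xi x = Datum d) /\ peval xi p.

(* A set of pairs (name, set) in which each name occurs at most once. *)
Definition family := name V -> option (set (obj V)).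

Section Family.
Variable M : family.

(* The value [o] of the variable of [s] is allowed by [s] under [xi]. *)
Definition selects (s : selector Sg) (xi : assignment) (o : obj V) : Prop :=
  exists v A, [/\ ivalue xi (sindex s) v, M (stype s, v) = Some A &
    match spat s with
    | None => A o
    | Some i => exists2 d, o = Datum d & A (Name (i, Some d))
    end].

Definition acceptable (U : hierarchy Sg) (xi : assignment) : Prop :=
  forall L s, List.In L U -> List.In s L -> selects s xi (xi (svar s)).

Definition Sigma (phi : form Sg) (v : option V) : set assignment :=
  [set xi | acceptable (fsel phi) xi /\ ivalue xi (findex phi) v].

Fixpoint quantified (q : prefix Sg) (K : assignment -> Prop) (xi : assignment) : Prop :=
  match q with
  | [::] => K xi
  | (Forall, s) :: q' =>
      forall o, selects s xi o -> quantified q' K (update xi (svar s) o)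
  | (Exists, s) :: q' =>
      exists2 o, selects s xi o & quantified q' K (update xi (svar s) o)
  end.

(* S(F, J); whether parameters are selected depends on the family. *)
Definition concrete_names (F : system Sg) : set (name V) :=
  [set n | exists phi, [/\ List.In phi F, ftype phi = n.1
                           & Sigma phi n.2 !=set0]].

Definition elements (F : system Sg) : set (obj V) :=
  (@Datum V @` data) `|` (@Name V @` concrete_names F).

Definition named_family (F : system Sg) : Prop :=
  forall n A, M n = Some A -> concrete_names F n /\ A `<=` elements F.

Definition base_elements (phi : form Sg) (v : option V) (i0 : nat) (t0 : index Sg) :
    set (obj V) :=
  [set o | exists xi v0 A, [/\ Sigma phi v xi, ivalue xi t0 v0,
                               M (i0, v0) = Some A & A o]].

Definition beta_true (phi : form Sg) (v : option V) (q : prefix Sg) (p : pexp Sg) : Prop :=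
  forall xi, Sigma phi v xi ->
    quantified q (fun xi' => pholds xi' (qvars q ++ ivars (findex phi)) p) xi.

Definition gamma_true (phi : form Sg) (v : option V) (x y : nat) (q : prefix Sg)
    (p : pexp Sg) (d0 d : obj V) : Prop :=
  forall xi, Sigma phi v xi ->
    quantified q
      (fun xi' => pholds xi' (x :: y :: qvars q ++ ivars (findex phi)) p)
      (update (update xi x d0) y d).

Definition gamma_closed (F : system Sg) (phi : form Sg) (v : option V) (x y : nat)
    (q : prefix Sg) (p : pexp Sg) (X : set (obj V)) : Prop :=
  forall d0, elements F d0 ->
    (exists2 d, X d & gamma_true phi v x y q p d0 d) -> X d0.

Definition agreed_form (F : system Sg) (phi : form Sg) : Prop :=
  let i := ftype phi in
  let t := findex phi in
  match fbody phi with
  | Alpha cs =>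
      forall xi v, ivalue xi t v ->
        M (i, v) = Some [set o | List.In o (map cvalue cs)]
  | Beta q p =>
      forall v, (exists A, M (i, v) = Some A) <->
        [/\ value_on_data t v, Sigma phi v !=set0 & beta_true phi v q p]
  | Gamma i0 t0 x y q p =>
      forall v A, M (i, v) = Some A <->
        [/\ value_on_data t v, Sigma phi v !=set0 &
            A = smallest (gamma_closed F phi v x y q p) (base_elements phi v i0 t0)]
  | Delta t0 =>
      forall v A, M (i, v) = Some A <->
        [/\ value_on_data t v, Sigma phi v !=set0 &
            A = elements F `&` [set o | exists2 xi, Sigma phi v xi & value xi t0 o]]
  end.

Definition agreed (F : system Sg) : Prop :=
  named_family F /\ forall phi, List.In phi F -> agreed_form F phi.

End Family.

Definition enlarges_one (M M' : family) : Prop :=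
  exists n A B, [/\ M n = Some A, M' n = Some B, A `<` B
                  & forall m, m <> n -> M' m = M m].

Definition selected (F : system Sg) (M : family) : Prop :=
  agreed M F /\ forall M', enlarges_one M M' -> ~ agreed M' F.

(* A system may have several variants of selection; [None] means that the
   name is absent from the selected family. *)
Definition selected_sets (F : system Sg) (n : name V) : set (option (set (obj V))) :=
  [set M n | M in [set M | selected F M]].

End Semantics.

(* Secondary predicates belong to the forms, so similar interpretations agree
   on everything an interpretation specifies. *)
Definition similar (Sg : signature) (V : Type) (J1 J2 : interpretation Sg V) : Prop :=
  [/\ Omega J1 = Omega J2, OmegaL J1 = OmegaL J2,
      forall c, cst J1 c = cst J2 c,
      forall (P : psym Sg) vs, @prd _ _ J1 P vs = @prd _ _ J2 P vs
    & forall (f : fsym Sg) vs, @fn _ _ J1 f vs = @fn _ _ J2 f vs].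

Definition equivalent (Sg : signature) (F1 F2 : system Sg) (i : nat) (a : cindex) : Prop :=
  forall (V : Type) (J1 : interpretation Sg V),
  exists2 J2 : interpretation Sg V, similar J1 J2 &
    selected_sets J1 F1 (cname J1 i a) = selected_sets J2 F2 (cname J2 i a).

Definition system_class := forall Sg : signature, system Sg -> Prop.

Definition class_ge (Phi1 Phi2 : system_class) : Prop :=
  forall (Sg : signature) (F2 : system Sg), Phi2 Sg F2 ->
  forall (i : nat) (a : cindex),
  exists2 F1 : system Sg, Phi1 Sg F1 & equivalent F1 F2 i a.

Definition class_lt (Phi2 Phi1 : system_class) : Prop :=
  class_ge Phi1 Phi2 /\ ~ class_ge Phi2 Phi1.

Definition G : system_class := fun Sg F => wf_system F.

Definition Gnobeta : system_class :=
  fun Sg F => wf_system F /\ ~~ has (@is_beta Sg) F.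

(* Main.v *)
From mathcomp Require Import all_boot.
From mathcomp Require Import boolp classical_sets cardinality.
From Stdlib Require List.
Require Import Defs.

Set Implicit Arguments.
Unset Strict Implicit.
Unset Printing Implicit Defensive.

Local Open Scope classical_set_scope.

(** Over a universe with a single datum, a form of type gamma cannot make use of
    its predicate: the predicate only relates data, and the unique datum [d0] it
    could add is already the datum [d] it is added from.  Without forms of type
    beta the selected families are therefore the same whatever the predicate
    symbols mean.  In contrast, the form of type beta [S = {P(c)}] has its name in
    the selected family exactly when [P(c)] holds. *)

(** A scoped prefix never rebinds a variable of [bound], so every assignment reached at its end
    agrees with [xi] there. This is how the values of [x] and [y] in a form of type gamma survive
    its quantifiers. *)
Lemma quantified_impl (Sg : signature) (V : Type) (J : interpretation Sg V)
    (M : family V) (q : prefix Sg) (bound : seq nat)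
    (K K' : assignment V -> Prop) (xi : assignment V) :
  scoped_prefix bound q ->
  (forall xi', {in bound, xi' =1 xi} -> K xi' -> K' xi') ->
  quantified J M q K xi -> quantified J M q K' xi.
Proof.
elim: q bound xi => [|[Q s] q IHq] bound xi /=; first by move=> _; apply.
case=> _ s_new q_scoped KK'.
have step o : quantified J M q K (update xi (svar s) o) ->
              quantified J M q K' (update xi (svar s) o).
  apply: IHq q_scoped _ => xi' xi'E; apply: KK' => z z_bound.
  rewrite xi'E ?inE ?z_bound ?orbT // /update; case: eqP => // zs.
  by rewrite -zs z_bound in s_new.
case: Q => [H o /H /step //|[o so /step H]].
by exists o.
Qed.

(** * Independence of the predicates over a one-element universe *)

Section OneDatum.
Variables (Sg : signature) (V : Type).
Hypothesis all_eq : forall a b : V, a = b.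

(** Predicates do not enter [value], and constants and functions have only one possible result. The
    notions built from [value] and [data] inherit this independence by rewriting. *)
Lemma one_datum_value (J1 J2 : interpretation Sg V) : value J1 = value J2.
Proof.
apply/funext => xi; apply/funext => t; apply/funext => o.
have impl J J' : value J xi t o -> value J' xi t o.
  elim=> [x|c|f ts vs _ IH]; first exact: value_var.
    by rewrite (all_eq (cst J c) (cst J' c)); exact: value_con.
  by rewrite (all_eq (fn J vs) (fn J' vs)); exact: value_app.
by apply/propext; split; exact: impl.
Qed.

Lemma one_datum_data (J : interpretation Sg V) : data J = setT.
Proof.
by apply/seteqP; split=> // a _; rewrite (all_eq a (cst J 0)); exact: cst_in.
Qed.

Lemma one_datum_ivalue (J1 J2 : interpretation Sg V) : ivalue J1 = ivalue J2.
Proof. by rewrite /ivalue (one_datum_value J1 J2). Qed.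

Lemma one_datum_value_on_data (J1 J2 : interpretation Sg V) :
  value_on_data J1 = value_on_data J2.
Proof. by rewrite /value_on_data !one_datum_data (one_datum_ivalue J1 J2). Qed.

Lemma one_datum_cst (J1 J2 : interpretation Sg V) : cst J1 = cst J2.
Proof. by apply/funext. Qed.

Lemma one_datum_cvalue (J1 J2 : interpretation Sg V) : cvalue J1 = cvalue J2.
Proof. by rewrite /cvalue /cname (one_datum_cst J1 J2). Qed.

Lemma one_datum_selects (J1 J2 : interpretation Sg V) : selects J1 = selects J2.
Proof. by rewrite /selects (one_datum_ivalue J1 J2). Qed.

Lemma one_datum_quantified (J1 J2 : interpretation Sg V) :
  quantified J1 = quantified J2.
Proof. by rewrite /quantified (one_datum_selects J1 J2). Qed.

Lemma one_datum_Sigma (J1 J2 : interpretation Sg V) : Sigma J1 = Sigma J2.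
Proof.
by rewrite /Sigma /acceptable (one_datum_selects J1 J2) (one_datum_ivalue J1 J2).
Qed.

Lemma one_datum_concrete_names (J1 J2 : interpretation Sg V) :
  concrete_names J1 = concrete_names J2.
Proof. by rewrite /concrete_names (one_datum_Sigma J1 J2). Qed.

Lemma one_datum_elements (J1 J2 : interpretation Sg V) :
  elements J1 = elements J2.
Proof. by rewrite /elements !one_datum_data (one_datum_concrete_names J1 J2). Qed.

Lemma one_datum_base_elements (J1 J2 : interpretation Sg V) :
  base_elements J1 = base_elements J2.
Proof.
by rewrite /base_elements (one_datum_Sigma J1 J2) (one_datum_ivalue J1 J2).
Qed.

Lemma one_datum_gamma_closed (J1 J2 : interpretation Sg V) (M : family V)
    (F : system Sg) (phi : form Sg) v x y q p :
  x != y -> scoped_prefix (x :: y :: ivars (findex phi)) q ->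
  gamma_closed J1 M F phi v x y q p = gamma_closed J2 M F phi v x y q p.
Proof.
move=> xy q_scoped; apply/funext => X.
have impl J J' : gamma_closed J M F phi v x y q p X ->
                 gamma_closed J' M F phi v x y q p X.
  move=> closedX d0 d0_elt [d Xd H].
  (* Two data coincide, and then [X d0] is just [X d]. Only the case where [d0] or [d] is a set name
     remains. *)
  suff [[->]//|not_data] : d0 = d \/ ~ exists a b, d0 = Datum a /\ d = Datum b.
    apply: closedX; first by rewrite (one_datum_elements J J').
    exists d => // xi; rewrite (one_datum_Sigma J J') => /H.
    rewrite (one_datum_quantified J' J).
    (* A set name makes [pholds] false at every assignment reached. The quantified formula can then
       hold only vacuously, which does not depend on the predicates. *)
    apply: quantified_impl q_scoped _ => xi' xi'E [is_datum _]; exfalso.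
    apply: not_data.
    have [|a xa] := is_datum x; first by rewrite inE eqxx.
    have [|b yb] := is_datum y; first by rewrite !inE eqxx orbT.
    exists a, b; rewrite -xa -yb !xi'E ?inE ?eqxx ?orbT //.
    by rewrite /update !eqxx (negPf xy).
  case: d0 {d0_elt H} => [a|n]; last by right=> -[? [? []]].
  case: d {Xd} => [b|n]; first by left; rewrite (all_eq a b).
  by right=> -[? [? []]].
by apply/propext; split; exact: impl.
Qed.

Lemma one_datum_agreed_form (J1 J2 : interpretation Sg V) (M : family V)
    (F : system Sg) (phi : form Sg) :
  wf_form phi -> ~~ is_beta phi ->
  agreed_form J1 M F phi = agreed_form J2 M F phi.
Proof.
rewrite /wf_form /is_beta /agreed_form.
case: (fbody phi) => [cs|//|i0 t0 x y q p|t0] [_ _ wf_b] _.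
- by rewrite (one_datum_ivalue J1 J2) (one_datum_cvalue J1 J2).
- case: wf_b => _ /and3P[xy _ _] q_scoped _.
  rewrite (one_datum_value_on_data J1 J2) (one_datum_Sigma J1 J2).
  rewrite (one_datum_base_elements J1 J2).
  by under eq_forall => v do
    rewrite (one_datum_gamma_closed J1 J2 M F v p xy q_scoped).
- rewrite (one_datum_value_on_data J1 J2) (one_datum_Sigma J1 J2).
  by rewrite (one_datum_elements J1 J2) (one_datum_value J1 J2).
Qed.

Lemma nobeta_form (F : system Sg) (phi : form Sg) :
  ~~ has (@is_beta Sg) F -> List.In phi F -> ~~ is_beta phi.
Proof.
elim: F => [//|psi F IHF] /=; rewrite negb_or => /andP[psi_nobeta F_nobeta].
by case=> [<- //|]; exact: IHF.
Qed.

Lemma one_datum_agreed (J1 J2 : interpretation Sg V) (F : system Sg)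
    (M : family V) :
  Gnobeta F -> agreed J1 M F = agreed J2 M F.
Proof.
move=> [[wfF _ _] F_nobeta]; rewrite /agreed /named_family.
rewrite (one_datum_concrete_names J1 J2) (one_datum_elements J1 J2).
congr (_ /\ _); apply/propext; split=> H phi phiF; move: (H phi phiF);
  by rewrite (one_datum_agreed_form J1 J2) //;
     [exact: wfF | exact: nobeta_form phiF].
Qed.

Lemma one_datum_selected_sets (J1 J2 : interpretation Sg V) (F : system Sg) :
  Gnobeta F -> selected_sets J1 F = selected_sets J2 F.
Proof.
move=> F_nobeta; have agreedE M := one_datum_agreed J1 J2 M F_nobeta.
suff sel_eq : selected J1 F = selected J2 F by rewrite /selected_sets sel_eq.
apply/funext => M; rewrite /selected agreedE.
by under eq_forall => M' do rewrite agreedE.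
Qed.

End OneDatum.

(** * A single form of type beta expressing a fact *)

Definition one_psym : signature :=
  @Signature unit (fun=> 1) void (fun=> 0).

Definition fact_form : form one_psym :=
  Form 0 None (Beta [::] (@Atom one_psym tt (fun=> Con one_psym 0))) [::].

Definition fact_system : system one_psym := [:: fact_form].

Lemma wf_fact_system : wf_system fact_system.
Proof.
split=> [phi /= [<-|//]|//|//]; split=> //; split=> //=.
  by split=> // i j; rewrite ltn0 andbF.
by move=> x /flattenP[s /mapP[k _ ->]].
Qed.

Section FactSystem.
Variables (V : Type) (J : interpretation one_psym V).

Let fact : bool := @prd _ _ J tt (fun=> cst J 0).

Lemma fact_beta_true (M : family V) :
  beta_true J M fact_form None [::] (@Atom one_psym tt (fun=> Con one_psym 0))
  <-> fact.
Proof.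
split=> [H|factT xi _].
  (* The hierarchy is empty, so any assignment is acceptable; the constant supplies an inhabitant of
     the abstract type [V]. *)
  have [|_ [vs vsE]] := H (fun=> Datum (cst J 0)); first by split.
  suff -> : vs = (fun=> cst J 0) by [].
  by apply/funext => k; move: (vsE k); inversion 1.
by split=> //; exists (fun=> cst J 0) => // k; exact: value_con.
Qed.

(** With no selectors, acceptability does not involve [M]. All families thus share the same
    [elements], which gives a common upper bound for the sets in them. *)
Lemma fact_concrete_names (M : family V) :
  concrete_names J M fact_system = [set (0, None)].
Proof.
apply/seteqP; split=> [[i [v|]] [phi [[<-|//] /= <- [xi [_ //]]]]|_ ->] //.
by exists fact_form; split; [left | | exists (fun=> Datum (cst J 0)); split].
Qed.

Lemma fact_value_on_data : value_on_data J None None.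
Proof. by exists (fun=> Datum (cst J 0)). Qed.

Lemma fact_agreed_defined (M : family V) A :
  agreed J M fact_system -> M (0, None) = Some A -> fact.
Proof.
move=> [_ /(_ fact_form (or_introl erefl) None)[H _] MA].
by have [_ _ /fact_beta_true] := H (ex_intro _ A MA).
Qed.

(** A form of type beta constrains whether its name occurs, not the contents of the named set.
    Taking all of [elements] as that set leaves no room for enlargement. *)
Lemma fact_selected_defined :
  fact -> exists2 M, selected J fact_system M & M (0, None) <> None.
Proof.
move=> factT.
have eltE (M M' : family V) : elements J M fact_system = elements J M' fact_system.
  by rewrite /elements !fact_concrete_names.
pose E := elements J (fun=> None) fact_system.
pose M : family V := fun n => if n is (0, None) then Some E else None.
have M_def n A : M n = Some A -> n = (0, None) /\ A = E.
  by case: n => [[|i] [v|]] //= [<-].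
exists M => //; split; first split.
- move=> n A /M_def[-> ->]; rewrite fact_concrete_names; split=> //.
  by rewrite (eltE M (fun=> None)).
- move=> phi [<-|//]; rewrite /agreed_form /= => -[a|].
    by split=> [[]|[_ [xi [_ []]]]].
  split=> _; last by exists E.
  split; [exact: fact_value_on_data | | exact/fact_beta_true].
  by exists (fun=> Datum (cst J 0)); split.
- move=> M' [n [A [B [/M_def[-> ->] M'B [_ notBE] _]]]] [named _].
  apply: notBE; have [_] := named _ _ M'B.
  by rewrite (eltE M' (fun=> None)).
Qed.

End FactSystem.

Lemma unit_finite (A : set unit) : finite_set A.
Proof. exact: finite_finset. Qed.

Definition unit_interpretation (b : bool) : interpretation one_psym unit :=
  @Interpretation one_psym unit setT set0 (fun=> tt) (fun _ _ => b)
    (fun f _ => match f with end) (unit_finite _) (unit_finite _)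
    (@sub0set _ _) (fun=> or_introl I).

Theorem theorem4p5p3 : class_lt Gnobeta G.
Proof.
split=> [Sg F [wfF _] i a | /(_ one_psym fact_system wf_fact_system 0 None)].
  by exists F => // V J; exists J.
case=> F F_nobeta equivF.
have [JT simT eqT] := equivF unit (unit_interpretation true).
have [JF simF eqF] := equivF unit (unit_interpretation false).
have [_ _ _ prdT _] := simT; have [_ _ _ prdF _] := simF.
have [|M selM Mdef] := @fact_selected_defined _ JT; first by rewrite -prdT.
have all_eq (a b : unit) : a = b by case: a; case: b.
(* The defined set passes from [fact_system] under [JT] to [F] with the predicate true, then to [F]
   with the predicate false, and finally to [fact_system] under [JF], where it would force the false
   fact. *)
have : selected_sets JT fact_system (0, None) (M (0, None)) by exists M.
rewrite -[selected_sets JT _ _]eqT.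
rewrite (one_datum_selected_sets all_eq _ (unit_interpretation false)) //.
rewrite [selected_sets _ F _]eqF => -[M' [agrM' _]].
case: (M (0, None)) Mdef => // A _ /(fact_agreed_defined agrM').
by rewrite -prdF.
Qed.
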